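(* Let $d\mu(t)=e^{-t}\mathbf 1_{t>0}\,dt$ be the exponential measure. Let $c\in(0,1)$ and let $f:[0,+\infty)\to(0,+\infty)$ be such that $|f'/f|<c$. Then $$\mathrm{Ent}_\mu(f)\le\frac4{(1-c)^2}\int_{\mathbb R}\frac{{f'}^2}f\,d\mu.$$
   Context: $f$ is a smooth function, and $\mathrm{Ent}_\mu(f)=\int f\log\left(f/\int f\,d\mu\right)d\mu$. *)

(* Defs.v *)
From HB Require Import structures.
From mathcomp Require Import all_boot all_order all_algebra.
From mathcomp Require Import all_classical all_reals all_analysis.

Set Implicit Arguments.
Unset Strict Implicit.
Unset Printing Implicit Defensive.

Import Order.TTheory GRing.Theory Num.Theory.
Import numFieldNormedType.Exports.

Local Open Scope classical_set_scope.
Local Open Scope ring_scope.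

(* The library density is expR (- t) on [0, +oo[ and 0 elsewhere; it differs
   from e^-t 1_{t > 0} only at the Lebesgue-null point t = 0.  The library's
   measure structure on exponential_prob takes a proof that the rate is
   positive, which unification cannot find: hence the tactic. *)
Definition exponential_measure (R : realType) :
    probability (measurableTypeR R) R.
Proof. by unshelve refine (exponential_prob (1 : R)); exact: ltr01. Defined.

(* A function on D is represented by a total function R -> R whose values
   outside D are arbitrary.  The definitions below only read values on D. *)

(* Derivative relative to D: the increment h ranges over the nonzero reals with
   h + x in D.  For D = [0, +oo[, this is the right derivative at 0 and the
   ordinary derivative at x > 0. *)
Definition diff_quotient_in (R : realType) (D : set R) (f : R -> R) (x : R) :=
  (h^-1 * (f (h + x) - f x)) @[h --> within [set h | D (h + x)] 0^'].

Definition derivable_in (R : realType) (D : set R) (f : R -> R) (x : R) : Prop :=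
  cvg (diff_quotient_in D f x).

Definition derive_in (R : realType) (D : set R) (f : R -> R) (x : R) : R :=
  lim (diff_quotient_in D f x).

Definition smooth_in (R : realType) (D : set R) (f : R -> R) : Prop :=
  forall (n : nat) (x : R), D x -> derivable_in D (iter n (derive_in D) f) x.

(* D is meant to be a set of full measure on which f is defined. *)
Definition entropy (d : measure_display) (T : measurableType d) (R : realType)
    (mu : {measure set T -> \bar R}) (D : set T) (f : T -> R) : \bar R :=
  (\int[mu]_(x in D) (f x * ln (f x / (\int[mu]_(y in D) f y)%R))%:E)%E.

(* Main.v *)
Require Import Defs.
From mathcomp Require Import all_boot all_order all_algebra.
From mathcomp Require Import all_classical all_reals all_analysis.
From mathcomp Require Import measurable_realfun ring lra.
Import Order.TTheory GRing.Theory Num.Theory.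
Import numFieldNormedType.Exports.
Local Open Scope classical_set_scope.
Local Open Scope ring_scope.

(** The entropy is a minimum over centerings: Ent(f) <= int phi_a for every
a > 0, where phi_a = f ln (f / a) - f + a >= 0 ([entropy_le_deficit]).  The
choice a = f 0 makes phi and g = ln (f / f 0) vanish at the origin, which is
what the exponential measure rewards: as e^-t is its own tail, a bound
u + W' <= v + W with W >= 0 integrates to int u <= int v + W(0)
([le_integral_exponential]): the boundary term - W(b) e^-b of the integration by
parts on [0, b] has a favourable sign, for every b.

The bound is applied with u = phi and W = phi + f g^2 / 2.  The first summand of
W turns int phi into int f' g; the second is the integration by parts behind the
Hardy inequality that controls g in L^2(f dmu) by g' = f' / f.  Adding the two
leaves the pointwise inequality

  2 f' g + f' g^2 / 2 <= 2 / (1 - c) * f'^2 / f + f g^2 / 2,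

a perfect square once f' <= c f ([tilted_square_bound]).  Hence the entropy is at
most 2 / (1 - c) times the Fisher information, and 2 / (1 - c) is at most its
square as 0 < c < 1.  The same bound with u = (1 - c) f, v = 0, W = f gives
the integrability of f ([integrable_log_derivative_lt]). *)

(** * Integration against a measure with a density *)

Lemma density_dominates d (T : measurableType d) (R : realType)
    (nu : {finite_measure set T -> \bar R})
    (mu : {sigma_finite_measure set T -> \bar R}) (p : T -> \bar R) :
  mu.-integrable setT p ->
  (forall A, measurable A -> nu A = \int[mu]_(x in A) p x)%E ->
  nu `<< mu.
Proof.
move=> ip nup; apply/null_content_dominatesP => A mA muA0.
rewrite nup// null_set_integral//.
by apply: measurable_funTS; exact: measurable_int ip.
Qed.

(** The Radon-Nikodym derivative of nu with respect to mu agrees with p almost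
everywhere, since both integrate to nu over every measurable set; the change of
variables for the former then carries over to p. *)
Lemma ge0_integral_density d (T : measurableType d) (R : realType)
    (nu : {finite_measure set T -> \bar R})
    (mu : {sigma_finite_measure set T -> \bar R}) (p : T -> \bar R)
    (D : set T) (h : T -> \bar R) :
  mu.-integrable setT p ->
  (forall A, measurable A -> nu A = \int[mu]_(x in A) p x)%E ->
  measurable D -> measurable_fun D h -> (forall x, D x -> 0 <= h x)%E ->
  (\int[nu]_(x in D) h x = \int[mu]_(x in D) (h x * p x))%E.
Proof.
move=> ip nup mD mh h0.
have dom := @density_dominates _ _ _ nu mu p ip nup.
pose q := Radon_Nikodym_SigmaFinite.f nu mu.
have iq : mu.-integrable setT q by exact: Radon_Nikodym_SigmaFinite.f_integrable.
have mp : measurable_fun D p by apply: measurable_funTS; exact: measurable_int ip.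
have mq : measurable_fun D q by apply: measurable_funTS; exact: measurable_int iq.
have qp : ae_eq mu D q p.
  apply: integral_ae_eq => //; first exact: integrableS iq.
  by move=> E ED mE; rewrite -Radon_Nikodym_SigmaFinite.f_integral// nup.
have hD : {in D, h =1 h \_ D} by move=> x xD; rewrite patchE xD.
rewrite (eq_integral _ _ hD).
rewrite -(@Radon_Nikodym_SigmaFinite.change_of_variables _ _ _ _ mu)//.
- apply: ae_eq_integral => //.
  + apply: emeasurable_funM => //.
    by apply: measurable_funTS; exact/(measurable_restrictT h).
  + exact: emeasurable_funM.
  + by apply: filterS qp => x /= qpx Dx; rewrite patchE mem_set// -qpx.
- by move=> x; apply: erestrict_ge0.
- by apply: measurable_funTS; exact/(measurable_restrictT h).
Qed.

Lemma ge0_integral_exponential (R : realType) (D : set R) (h : R -> R) :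
  measurable D -> D `<=` `[0, +oo[ -> measurable_fun D h ->
  (forall x, D x -> 0 <= h x) ->
  (\int[exponential_measure R]_(x in D) (h x)%:E =
   \int[lebesgue_measure]_(x in D) (h x * expR (- x))%:E)%E.
Proof.
move=> mD D0 mh h0.
rewrite (@ge0_integral_density _ _ _ (exponential_measure R) lebesgue_measure
  (fun x => (exponential_pdf 1 x)%:E))//.
- apply: eq_integral => x; rewrite inE => /D0/=; rewrite in_itv/= andbT => x0.
  by rewrite exponential_pdfE// mul1r mulN1r EFinM.
- exact: integrable_exponential_pdf.
- exact/measurable_EFinP.
Qed.

(** * Derivatives relative to a set *)

(** The constraint on the increments is vacuous near 0 when D is a
neighbourhood of the point. *)
Lemma is_derive_derive_in (R : realType) (D : set R) (f : R -> R) (x : R) :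
  nbhs x D -> derivable_in D f x -> is_derive x 1 f (derive_in D f x).
Proof.
move=> Dx; rewrite /derivable_in /derive_in.
suff -> : diff_quotient_in D f x =
    (h^-1 *: ((f \o shift x) (h *: 1) - f x) @[h --> 0^']).
  by move=> df; split.
rewrite /diff_quotient_in; under eq_fun do rewrite -[X in X + x]mulr1.
suff -> : within [set h | D (h + x)] 0^' = 0^' by [].
have Dh : \forall h \near (0 : R)^', D (h + x).
  apply: nbhs_dnbhs.
  have : (fun h : R => h + x) @ (0 : R) --> 0 + x.
    by apply: cvgD; [exact: cvg_id|exact: cvg_cst].
  by rewrite add0r; exact.
apply/seteqP; split=> P; rewrite /within/=; last first.
  by apply: filterS => h Ph _.
by move=> DP; near=> h; apply: (near DP h) => //; near: h.
Unshelve. all: by end_near. Qed.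

(** Bridges the relative derivative to the subspace topology, which is the one in
which the fundamental theorem of calculus and measurability are phrased. *)
Lemma derivable_in_continuous (R : realType) (D : set R) (f : R -> R) (x : R) :
  derivable_in D f x -> f @ within D (nbhs x) --> f x.
Proof.
rewrite /derivable_in /diff_quotient_in; set G := within _ _ => df.
have fG : f (h + x) @[h --> G] --> f x.
  have idG : (h : R) @[h --> G] --> (0 : R).
    by do 2 apply: cvg_within_filter; exact: cvg_id.
  have fxG : h * (h^-1 * (f (h + x) - f x)) + f x @[h --> G] --> f x.
    have := cvgD (cvgM idG df) (cvg_cst (f x)); rewrite mul0r add0r; exact.
  have G0 : \forall h \near G, (h : R) != 0.
    apply: cvg_within. exact: (@nbhs_dnbhs_neq R 0).
  apply: cvg_trans fxG; apply: near_eq_cvg; apply: filterS G0 => h h0.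
  by rewrite mulrA divff// mul1r subrK.
(* The increment 0 is excluded from the filter of the difference quotient; there
   the value is f x itself, which lies in U. *)
move=> U Ux.
have xx : (y - x) @[y --> x] --> (0 : R).
  by rewrite -(subrr x); apply: cvgB; [exact: cvg_id|exact: cvg_cst].
have Uxx : \forall y \near x, y - x != 0 -> D (y - x + x) -> U (f (y - x + x)).
  exact: xx _ (fG _ Ux).
change (\forall y \near x, D y -> U (f y)).
near=> y => Dy; have : y - x != 0 -> D (y - x + x) -> U (f (y - x + x)).
  by near: y.
rewrite subrK subr_eq0 => yxU.
by have [->|/yxU/(_ Dy)//] := eqVneq y x; exact: nbhs_singleton.
Unshelve. all: by end_near. Qed.

(** * A one-sided integration by parts for the exponential measure *)

Lemma continuous_expRN (R : realType) : continuous (fun x : R => expR (- x)).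
Proof.
by move=> x; apply: continuous_comp; [exact: continuousN|exact: continuous_expR].
Qed.

(** (W - W') e^-t is the derivative of - W e^-t. *)
Lemma integral_damped_derivative (R : realType) (W W1 : R -> R) (b : R) :
  0 < b ->
  {within `[0, +oo[, continuous W} -> {within `[0, +oo[, continuous W1} ->
  (forall x : R, 0 < x -> is_derive x 1 W (W1 x)) ->
  (\int[lebesgue_measure]_(x in `[0%R, b]) ((W x - W1 x) * expR (- x))%:E =
   (W 0%R - W b * expR (- b))%:E)%E.
Proof.
move=> b0 cW cW1 dW.
have sub : `[0, b] `<=` `[0, +oo[ by exact: subset_itvl.
pose F x := - (W x * expR (- x)).
have dF (x : R) : 0 < x -> is_derive x 1 F ((W x - W1 x) * expR (- x)).
  move=> x0; have := dW x x0 => ?.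
  apply: is_derive_eq.
  rewrite /GRing.scale/=; ring.
rewrite (@continuous_FTC2 _ _ F)//.
- by rewrite /F oppr0 expR0 mulr1 -EFinB; congr EFin; ring.
- move=> x; apply: cvgM.
    apply: cvgB; first exact: (continuous_subspaceW sub cW).
    exact: (continuous_subspaceW sub cW1).
  by apply: continuous_subspaceT; exact: continuous_expRN.
- have cF : {within `[0, b], continuous F}.
    move=> x; apply: cvgN; apply: cvgM.
      exact: (continuous_subspaceW sub cW).
    by apply: continuous_subspaceT; exact: continuous_expRN.
  have [_ F0 Fb] := (continuous_within_itvP F b0).1 cF.
  by split => // x; rewrite in_itv/= => /andP[x0 _]; have [] := dF x x0.
- move=> x; rewrite in_itv/= => /andP[x0 _].
  by rewrite derive1E; have [] := dF x x0.
Qed.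

(** A comparison principle: W is a free choice, and e^-t W(t) plays the part of
a Lyapunov function.  On [0, b] the damped derivative of W contributes
W(0) - W(b) e^-b <= W(0), a bound uniform in b, and monotone convergence does
the rest. *)
Lemma le_integral_exponential (R : realType) (u v W W1 : R -> R) :
  {within `[0, +oo[, continuous u} -> {within `[0, +oo[, continuous v} ->
  {within `[0, +oo[, continuous W} -> {within `[0, +oo[, continuous W1} ->
  (forall x : R, 0 < x -> is_derive x 1 W (W1 x)) ->
  (forall x : R, 0 <= x -> 0 <= u x) -> (forall x : R, 0 <= x -> 0 <= v x) ->
  (forall x : R, 0 <= x -> 0 <= W x) ->
  (forall x : R, 0 <= x -> u x + W1 x <= v x + W x) ->
  (\int[exponential_measure R]_(x in `[0%R, +oo[) (u x)%:E <=
   \int[exponential_measure R]_(x in `[0%R, +oo[) (v x)%:E + (W 0)%:E)%E.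
Proof.
move=> cu cv cW cW1 dW u0 v0 W0 uv.
have meas (h : R -> R) : {within `[0, +oo[, continuous h} ->
    measurable_fun (`[0, +oo[ : set R) h.
  by move=> ch; exact: subspace_continuous_measurable_fun.
have sub (b : R) : `[0, b] `<=` `[0, +oo[ by exact: subset_itvl.
have pos (b x : R) : (`[0, b]%classic : set R) x -> 0 <= x.
  by rewrite /= in_itv/= => /andP[].
have mb (h : R -> R) (b : R) : {within `[0, +oo[, continuous h} ->
    measurable_fun (`[0, b] : set R) h.
  by move=> ch; apply: measurable_funS (meas h ch).
have int_b (h : R -> R) (b : R) : {within `[0, +oo[, continuous h} ->
    lebesgue_measure.-integrable `[0, b] (fun x => (h x * expR (- x))%:E).
  move=> ch; apply: continuous_compact_integrable; first exact: segment_compact.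
  move=> x; apply: cvgM; first exact: (continuous_subspaceW (sub b) ch).
  by apply: continuous_subspaceT; exact: continuous_expRN.
have cut (b : R) : 0 < b ->
    (\int[exponential_measure R]_(x in `[0%R, b]) (u x)%:E <=
     \int[exponential_measure R]_(x in `[0%R, b]) (v x)%:E + (W 0)%:E)%E.
  move=> b0.
  rewrite (@ge0_integral_exponential _ _ u)//; [|exact: mb|by move=> x /pos/u0].
  rewrite (@ge0_integral_exponential _ _ v)//; [|exact: mb|by move=> x /pos/v0].
  have cWW : {within `[0, +oo[, continuous (fun x => W x - W1 x)}.
    by move=> x; apply: cvgB; [exact: cW|exact: cW1].
  apply: (@le_trans _ _ (\int[lebesgue_measure]_(x in `[0%R, b])
     (v x * expR (- x) + (W x - W1 x) * expR (- x))%R%:E)%E).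
    apply: le_integral => //.
    - exact: int_b.
    - exact: (integrableD _ (int_b _ b cv) (int_b _ b cWW)).
    - move=> x; rewrite inE => /pos x0; rewrite lee_fin -mulrDl ler_pM2r ?expR_gt0//.
      by have := uv x x0; lra.
  rewrite integralD_EFin//; [|exact: int_b|exact: int_b].
  rewrite integral_damped_derivative// leeD2l// lee_fin gerBl.
  by rewrite mulr_ge0 ?expR_ge0// W0// ltW.
rewrite [in X in (X <= _)%E]itv0y_bigcup0S.
have ndF : nondecreasing_seq (fun n : nat => `[0, n.+1%:R]%classic : set R).
  move=> m n mn; rewrite subsetEset; apply: subset_itvl.
  by rewrite bnd_simp ler_nat.
have := @ge0_nondecreasing_set_cvg_integral _ (measurableTypeR R) _ _ (fun x => (u x)%:E)
  (exponential_measure R) ndF.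
move=> /(_ _ _ _)/cvg_lim <-//; last first.
- by move=> n x /pos/u0; rewrite lee_fin.
- by move=> n; apply/measurable_EFinP; exact: mb.
apply: lime_le.
  apply: ereal_nondecreasing_is_cvgn.
  apply: ge0_nondecreasing_set_nondecreasing_integral => //.
  - by move=> n; apply/measurable_EFinP; exact: mb.
  - by move=> n x /pos/u0; rewrite lee_fin.
apply: nearW => n; apply: le_trans (cut _ _) _ => //.
rewrite leeD2r//; apply: ge0_subset_integral => //.
- by apply/measurable_EFinP; exact: meas.
- by move=> x; rewrite /= in_itv/= andbT => /v0; rewrite lee_fin.
Qed.

(** * Entropy as a minimum over centerings *)

Lemma ln_le_subr1 (R : realType) (x : R) : 0 < x -> ln x <= x - 1.
Proof.
by move=> x0; rewrite -{1}(subrK 1 x) addrC le_ln1Dx//; lra.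
Qed.

(** The deficit is the gap between the convex function x ln x and its tangent line
at a. *)
Lemma xlogx_deficit_ge0 (R : realType) (a x : R) : 0 < a -> 0 < x ->
  0 <= x * ln (x / a) - x + a.
Proof.
move=> a0 x0; have := ln_le_subr1 R (a / x) (divr_gt0 a0 x0).
rewrite -(ler_pM2l x0) -(invf_div x a) lnV ?posrE ?divr_gt0// invf_div mulrBr.
rewrite mulrCA divff ?gt_eqF// => h; lra.
Qed.

(** With m = int f, the deficit at a differs from f ln (f / m) by an affine
function of f whose integral is m ln (m / a) - m + a, that is, the deficit of m
itself, which is nonnegative. *)
Lemma entropy_le_deficit d (T : measurableType d) (R : realType)
    (P : probability T R) (D : set T) (f : T -> R) (a : R) :
  measurable D -> P D = 1%E -> P.-integrable D (EFin \o f) ->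
  (forall x, D x -> 0 < f x) -> 0 < a ->
  (entropy P D f <= \int[P]_(x in D) (f x * ln (f x / a) - f x + a)%:E)%E.
Proof.
move=> mD PD intf f0 a0; rewrite /entropy.
set m := (\int[P]_(y in D) f y)%R; set phi := fun x => f x * ln (f x / a) - f x + a.
have phi0 x : D x -> 0 <= phi x by move=> /f0; exact: xlogx_deficit_ge0.
have I0 : (0 <= \int[P]_(x in D) (phi x)%:E)%E.
  by apply: integral_ge0 => x /phi0; rewrite lee_fin.
have m_ge0 : 0 <= m by apply: Rintegral_ge0 => x /f0/ltW.
(* When m = 0 the quotient f x / m is 0 by convention, and so is the logarithm. *)
have [m0|m_neq0] := eqVneq m 0.
  rewrite m0; under eq_integral do rewrite invr0 mulr0 ln0// mulr0.
  by rewrite integral0.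
have m0 : 0 < m by rewrite lt_neqAle eq_sym m_neq0.
(* Off the trivial infinite case, every term below is integrable. *)
have [->|Ifin] := eqVneq (\int[P]_(x in D) (phi x)%:E)%E +oo%E; first exact: leey.
have mf : measurable_fun D f by apply/measurable_EFinP; exact: measurable_int intf.
have mphi : measurable_fun D phi.
  apply: measurable_funD => //; apply: measurable_funB => //.
  apply: measurable_funM => //; apply: measurableT_comp => //.
  exact: measurable_funM.
have intphi : P.-integrable D (EFin \o phi).
  apply/integrableP; split; first exact/measurable_EFinP.
  rewrite (eq_integral (EFin \o phi)) ?ltey// => x; rewrite inE => /phi0 ?.
  by rewrite /= ger0_norm.
have inta : P.-integrable D (EFin \o cst a).
  by apply: finite_measure_integrable_cst.
have intZ : P.-integrable D (EFin \o (fun x => (1 - ln (m / a)) * f x)).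
  exact: (integrableZl mD _ intf).
rewrite (eq_integral (fun x => ((phi x)%:E +
    (((1 - ln (m / a)) * f x)%:E - (cst a x)%:E))%E)); last first.
  move=> x; rewrite inE => /f0 fx0; rewrite -EFinB -EFinD; congr EFin.
  rewrite /phi/= !ln_div ?posrE//; ring.
rewrite integralD//; last exact: integrableB intZ inta.
rewrite geeDl// integralB//.
rewrite [X in (_ - X)%E](_ : _ = a%:E); last first.
  by rewrite (integral_cst P mD a%:E) -[RHS]mule1 -PD.
under eq_integral do rewrite EFinM.
rewrite integralZl// -[(\int[P]_(x in D) _)%E]fineK ?integrable_fin_num//.
rewrite -EFinM -EFinB lee_fin -[fine _]/m.
by have h := xlogx_deficit_ge0 R a m a0 m0; lra.
Qed.

(** * Functions with a bounded logarithmic derivative *)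

Lemma smooth_in_continuous (R : realType) (D : set R) (f : R -> R) :
  smooth_in D f -> {within D, continuous f} /\ {within D, continuous derive_in D f}.
Proof.
move=> sf; split; apply/subspace_continuousP => x Dx.
- exact: derivable_in_continuous (sf 0%N x Dx).
- exact: derivable_in_continuous (sf 1%N x Dx).
Qed.

(** The difference of the two sides is the sum of (c y - y1) t^2 / 2 and of half of
(1 - c) y times the square of t - 2 y1 / ((1 - c) y). *)
Lemma tilted_square_bound (R : realType) (c y y1 t : R) :
  0 < y -> c < 1 -> y1 <= c * y ->
  2 * (y1 * t) + 2^-1 * (y1 * t ^+ 2) <=
  2 / (1 - c) * (y1 ^+ 2 / y) + 2^-1 * (y * t ^+ 2).
Proof.
move=> y0 c1 y1c; rewrite -subr_ge0.
have k0 : 0 < 1 - c by rewrite subr_gt0.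
rewrite (_ : _ - _ = 2^-1 * ((c * y - y1) * t ^+ 2) +
    2^-1 * ((1 - c) * y * (t - 2 * y1 / ((1 - c) * y)) ^+ 2)); last first.
  by field; rewrite !gt_eqF.
apply: addr_ge0; rewrite mulr_ge0 ?invr_ge0//;
  apply: mulr_ge0; rewrite ?sqr_ge0 ?subr_ge0//.
by rewrite mulr_ge0 ?ltW.
Qed.

Lemma exponential_measure0y (R : realType) :
  exponential_measure R `[0%R, +oo[%classic = 1%E.
Proof.
rewrite -[RHS](@integral_exponential_pdf R 1)//.
change (\int[lebesgue_measure]_(x in `[0%R, +oo[) (exponential_pdf 1 x)%:E =
  \int[lebesgue_measure]_x (@exponential_pdf R 1 x)%:E)%E.
rewrite integral_mkcond; apply: eq_integral => x _.
rewrite patchE; case: ifPn => // /negP x0.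
rewrite lt0_exponential_pdf// ltNge; apply/negP => h; apply: x0.
by rewrite inE/= in_itv/= h.
Qed.

Lemma continuous_fisher_density (R : realType) (D : set R) (f : R -> R) :
  smooth_in D f -> (forall x, D x -> 0 < f x) ->
  {within D, continuous (fun x => derive_in D f x ^+ 2 / f x)}.
Proof.
move=> /smooth_in_continuous[cf cf1] f_gt0.
apply/subspace_continuousP => x x0; apply: cvgM.
  by apply: cvgM; move/subspace_continuousP: cf1; exact.
apply: cvgV; last by move/subspace_continuousP: cf; exact.
by rewrite gt_eqF// f_gt0.
Qed.

Section log_derivative_bound.
Variables (R : realType) (c : R) (f : R -> R).
Hypotheses (c01 : 0 < c < 1) (smooth_f : smooth_in `[0, +oo[ f).
Hypothesis f_gt0 : forall x : R, 0 <= x -> 0 < f x.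
Hypothesis log_f : forall x : R, 0 <= x -> `|derive_in `[0, +oo[ f x / f x| < c.

Let f1 : R -> R := derive_in `[0, +oo[ f.
Let g x : R := ln (f x / f 0).
Let phi x : R := f x * g x - f x + f 0.

Let cf : {within `[0, +oo[, continuous f}.
Proof. exact: (smooth_in_continuous _ _ _ smooth_f).1. Qed.

Let cf1 : {within `[0, +oo[, continuous f1}.
Proof. exact: (smooth_in_continuous _ _ _ smooth_f).2. Qed.

Let df (x : R) : 0 < x -> is_derive x 1 f (f1 x).
Proof.
move=> x0; apply: is_derive_derive_in.
  by apply: filterS (lt_nbhsr x0) => y /ltW; rewrite /= in_itv/= andbT.
by apply: (smooth_f 0%N); rewrite /= in_itv/= ltW.
Qed.

Let f1_lt (x : R) : 0 <= x -> `|f1 x| < c * f x.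
Proof.
move=> x0; have := log_f x x0.
by rewrite normrM normfV (gtr0_norm (f_gt0 x x0)) ltr_pdivrMr// f_gt0.
Qed.

Let cg : {within `[0, +oo[, continuous g}.
Proof.
apply/subspace_continuousP => x; rewrite /= in_itv/= andbT => x0.
apply: (@continuous_cvg _ _ _ _ _ (fun y => f y / f 0) (@ln R)).
  by apply: continuous_ln; rewrite divr_gt0// f_gt0.
apply: cvgM; last exact: cvg_cst.
by move/subspace_continuousP : cf; apply; rewrite /= in_itv/= x0.
Qed.

Let dg (x : R) : 0 < x -> is_derive x 1 g (f1 x / f x).
Proof.
move=> x0; have fx0 := f_gt0 x (ltW x0); have f00 := f_gt0 0 (lexx 0).
have dfx := df x x0.
have dln : is_derive (f x / f 0) 1 (@ln R) (f x / f 0)^-1.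
  by apply: is_derive1_ln; rewrite divr_gt0.
have dq : is_derive x 1 (fun y => f y / f 0) (f1 x / f 0).
  apply: is_derive_eq; rewrite /GRing.scale/=; ring.
apply: (is_derive_eq (@is_derive1_comp _ _ (fun y => f y / f 0) x _ _ dln dq)).
by field; rewrite !gt_eqF.
Qed.

Lemma integrable_log_derivative_lt :
  (exponential_measure R).-integrable `[0, +oo[ (EFin \o f).
Proof.
have /andP[c0 c1] := c01.
have u0 (x : R) : 0 <= x -> 0 <= (1 - c) * f x.
  by move=> /f_gt0/ltW fx; rewrite mulr_ge0// subr_ge0 ltW.
have mf : measurable_fun (`[0, +oo[ : set R) f.
  exact: subspace_continuous_measurable_fun.
have bound : ((1 - c)%:E * \int[exponential_measure R]_(x in `[0%R, +oo[) (f x)%:E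
    <= (f 0)%:E)%E.
  rewrite -ge0_integralZl//; last 3 first.
  - exact/measurable_EFinP.
  - by move=> x; rewrite /= in_itv/= andbT => /f_gt0/ltW; rewrite lee_fin.
  - by rewrite lee_fin subr_ge0 ltW.
  rewrite -[leRHS]add0e.
  rewrite -[X in (X + _)%E](@integral0 _ (measurableTypeR R) _
    (exponential_measure R) `[0%R, +oo[%classic).
  apply: (@le_integral_exponential _ (fun x => (1 - c) * f x) (cst 0) f f1) => //.
  - by move=> x; apply: cvgM; [exact: cvg_cst|exact: cf].
  - by move=> x; exact: cvg_cst.
  - by move=> x /f_gt0/ltW.
  - move=> x x0; have := f1_lt x x0; rewrite ltr_norml => /andP[_ ?] /=; lra.
apply/integrableP; split; first exact/measurable_EFinP.
rewrite (@eq_integral _ (measurableTypeR R) _ _ _ (EFin \o f)); last first.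
  by move=> x; rewrite inE/= in_itv/= andbT => /f_gt0/ltW ?; rewrite ger0_norm.
by rewrite -lee_pdivlMl ?subr_gt0// in bound; rewrite (le_lt_trans bound)// -EFinM ltry.
Qed.

(** The weight 1/2 in front of f g^2 minimises the constant: a weight w gives
(1 + 2 w)^2 / (4 w (1 - c)), which is smallest at w = 1/2. *)
Lemma deficit_le_fisher :
  (\int[exponential_measure R]_(x in `[0%R, +oo[) (phi x)%:E <=
   \int[exponential_measure R]_(x in `[0%R, +oo[) (2 / (1 - c) * (f1 x ^+ 2 / f x))%:E)%E.
Proof.
have /andP[c0 c1] := c01.
have f00 := f_gt0 0 (lexx 0).
pose W x := phi x + 2^-1 * (f x * g x ^+ 2).
pose W1 x := 2 * (f1 x * g x) + 2^-1 * (f1 x * g x ^+ 2).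
have cphi : {within `[0, +oo[, continuous phi}.
  move=> x; apply: cvgD; last exact: cvg_cst.
  by apply: cvgB; [apply: cvgM; [exact: cf|exact: cg]|exact: cf].
have cg2 : {within `[0, +oo[, continuous (fun x => g x ^+ 2)}.
  by move=> x; apply: cvgM; exact: cg.
have phi0 (x : R) : 0 <= x -> 0 <= phi x.
  by move=> /f_gt0; exact: xlogx_deficit_ge0.
have W0 : W 0 = 0 by rewrite /W /phi /g divff ?gt_eqF// ln1; ring.
pose v x := 2 / (1 - c) * (f1 x ^+ 2 / f x).
suff : (\int[exponential_measure R]_(x in `[0%R, +oo[) (phi x)%:E <=
    \int[exponential_measure R]_(x in `[0%R, +oo[) (v x)%:E + (W 0)%:E)%E.
  by rewrite W0 adde0.
apply: (@le_integral_exponential _ _ _ W W1) => //.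
- move=> x; apply: cvgM; first exact: cvg_cst.
  apply: continuous_fisher_density => // y.
  by rewrite /= in_itv/= andbT; exact: f_gt0.
- move=> x; apply: cvgD; first exact: cphi.
  by apply: cvgM; [exact: cvg_cst|apply: cvgM; [exact: cf|exact: cg2]].
- move=> x; apply: cvgD.
    by apply: cvgM; [exact: cvg_cst|apply: cvgM; [exact: cf1|exact: cg]].
  by apply: cvgM; [exact: cvg_cst|apply: cvgM; [exact: cf1|exact: cg2]].
- move=> x x0; have dfx := df x x0; have dgx := dg x x0.
  have fx0 := f_gt0 x (ltW x0).
  apply: is_derive_eq; rewrite /GRing.scale/= /W1; field.
  by rewrite gt_eqF.
- move=> x x0; have fx := f_gt0 x x0.
  have k0 : 0 < 1 - c by rewrite subr_gt0.
  by apply: mulr_ge0; rewrite divr_ge0 ?sqr_ge0 ?ltW.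
- move=> x x0; rewrite addr_ge0 ?phi0// mulr_ge0 ?invr_ge0//.
  by rewrite mulr_ge0 ?sqr_ge0// ltW// f_gt0.
- move=> x x0; have fx := f_gt0 x x0.
  have := f1_lt x x0; rewrite ltr_norml => /andP[_ r_lt].
  have := tilted_square_bound _ _ _ _ (g x) fx c1 (ltW r_lt).
  by rewrite /W /W1 /v; lra.
Qed.

End log_derivative_bound.

Theorem proposition6p6 (R : realType) (c : R) (f : R -> R)
  (hc : 0 < c < 1)
  (hsmooth : smooth_in `[0, +oo[ f)
  (hpos : forall x : R, 0 <= x -> 0 < f x)
  (hlog : forall x : R, 0 <= x -> `|derive_in `[0, +oo[ f x / f x| < c) :
  (entropy (exponential_measure R) `[0%R, +oo[ f <=
   (4 / (1 - c) ^+ 2)%:E *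
   \int[exponential_measure R]_(x in `[0%R, +oo[)
     (derive_in `[0%R, +oo[ f x ^+ 2 / f x)%:E)%E.
Proof.
have /andP[c0 c1] := hc.
have k0 : 0 < 1 - c by rewrite subr_gt0.
apply: le_trans (entropy_le_deficit _ _ _ _ _ _ (f 0) _ _ _ _ _) _ => //.
- exact: exponential_measure0y.
- exact: (integrable_log_derivative_lt _ c).
- by move=> x; rewrite /= in_itv/= andbT; exact: hpos.
- exact: hpos.
apply: le_trans (deficit_le_fisher _ _ _ hc hsmooth hpos hlog) _.
under eq_integral do rewrite EFinM.
have cF : {within `[0, +oo[, continuous
    (fun x : R => derive_in `[0, +oo[ f x ^+ 2 / f x)}.
  apply: continuous_fisher_density => // x.
  by rewrite /= in_itv/= andbT; exact: hpos.
have I0 (x : R) : (`[0, +oo[%classic : set R) x ->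
    0 <= derive_in `[0, +oo[ f x ^+ 2 / f x.
  by rewrite /= in_itv/= andbT => /hpos/ltW ?; rewrite divr_ge0// sqr_ge0.
rewrite ge0_integralZl//; last 2 first.
- by apply/measurable_EFinP; apply: subspace_continuous_measurable_fun.
- by rewrite lee_fin divr_ge0// ltW.
apply: lee_wpmul2r; first by apply: integral_ge0 => x /I0; rewrite lee_fin.
(* 2 / (1 - c) is at least 1, so squaring it only weakens the bound. *)
have -> : 4 / (1 - c) ^+ 2 = 2 / (1 - c) * (2 / (1 - c)).
  by field; rewrite gt_eqF.
by rewrite lee_fin ler_peMr ?divr_ge0 ?(ltW k0)// ler_pdivlMr//; lra.
Qed.
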